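(* Consider the linear program (F-DOI stabilized set-covering problem) $$\min_{\theta,\xi}\ \sum_{l\in\Omega}c_l\theta_l-\sum_{u\in N,\ \sigma\in\Lambda_u}\sigma\,\xi_{u\sigma}$$ subject to $$\sum_{l\in\Omega}a_{ul}\theta_l-\sum_{\sigma\in\Lambda_u}\xi_{u\sigma}\ge 1\quad(u\in N),\qquad \xi_{u\sigma}-\sum_{l\in\Omega}\beta_{ul\sigma}\theta_l\le 0\quad(u\in N,\ \sigma\in\Lambda_u),$$ $$\theta_l\ge 0\quad(l\in\Omega),\qquad \xi_{u\sigma}\ge 0\quad(u\in N,\ \sigma\in\Lambda_u),$$ where $N,\Omega,a,c,\Lambda_u,\beta$ are as described in the context. This problem admits an optimal solution $(\theta^*,\xi^* )$ such that $\xi^*_{u\sigma}=0$ for every $u\in N$, $\sigma\in\Lambda_u$.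
   Context: $N$ is a set of items to be covered and $\Omega$ is the set of all feasible columns (typically exponentially large in the size of the input); $\Omega_R\subset\Omega$ is the restricted set of columns considered at a given time in column generation. Each column $l\in\Omega$ has a cost $c_l$, and for $u\in N$, $a_{ul}\in\{0,1\}$ equals $1$ if column $l$ covers item $u$ and $0$ otherwise (a column covers an item at most once). Write $N(l)=\{u\in N: a_{ul}=1\}$. Rebates: for each $l\in\Omega$ and $u\in N$ there is a number $\sigma_{ul}\ge 0$, with $\sigma_{ul}=0$ whenever $a_{ul}=0$. The values $(\sigma_{ul})_{u\in N,\,l\in\Omega}$ are assumed to satisfy the following property: for every column $l\in\Omega_R$ and every subset $S\subseteq N(l)$, $$\sum_{u\in S}\sigma_{ul}\le c_l-c_{l'},$$ where $l'=remove(l,S)\in\Omega$ is the column constructed from $l$ by removing the items in $S$. For $u\in N$, $\Lambda_u=\{\sigma_{ul}: l\in\Omega_R\}$ is the set of all values of $\sigma_{ul}$ across the restricted set $\Omega_R$. For $u\in N$, $l\in\Omega$ and $\sigma\in\Lambda_u$, $\beta_{ul\sigma}\in\{0,1\}$ equals $1$ if $\sigma_{ul}=\sigma$ and $0$ otherwise.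
   Formalization: Assumes the linear program is feasible and bounded below, and that the rebate property also holds for columns outside Ω_R, for sets S of covered items whose rebates are positive and lie in Λ_u; without these the claim is false. *)

(* Defs.v *)
From HB Require Import structures.
From mathcomp Require Import all_boot all_order all_algebra.
From mathcomp Require Import reals.

Set Implicit Arguments.
Unset Strict Implicit.
Unset Printing Implicit Defensive.

Import Order.TTheory GRing.Theory Num.Theory.
Local Open Scope ring_scope.

(* N(l), where [a u l] says that column [l] covers item [u] *)
Definition items (N Omega : finType) (a : N -> Omega -> bool) (l : Omega) :
  {set N} := [set u | a u l].

(* [remove l S] is a column covering exactly the items of [l] outside [S],
   and the rebates of the items of [S] do not exceed the cost saved.  Columns
   are abstract (different columns may cover the same items), so [remove] is a
   function on columns, of which only the set of covered items is known. *)
Definition rebate_bound (R : realType) (N Omega : finType)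
    (a : N -> Omega -> bool) (c : Omega -> R) (sigma : N -> Omega -> R)
    (remove : Omega -> {set N} -> Omega) (l : Omega) (S : {set N}) : Prop :=
  items a (remove l S) = items a l :\: S /\
  \sum_(u in S) sigma u l <= c l - c (remove l S).

(* The set of values sigma_(u, l), l in OmegaR, as a list without repetition *)
Definition Lambda (R : realType) (N Omega : finType) (OmegaR : {set Omega})
    (sigma : N -> Omega -> R) (u : N) : seq R :=
  undup [seq sigma u l | l in OmegaR].

Definition beta (R : realType) (N Omega : finType) (sigma : N -> Omega -> R)
    (u : N) (l : Omega) (s : R) : bool := sigma u l == s.

(* The variable xi_(u, s) is [xi u s]; only its values at [s \in Lambda u]
   occur in the linear program. *)
Definition fdoi_objective (R : realType) (N Omega : finType)
    (OmegaR : {set Omega}) (c : Omega -> R) (sigma : N -> Omega -> R)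
    (theta : Omega -> R) (xi : N -> R -> R) : R :=
  \sum_(l : Omega) c l * theta l
  - \sum_(u : N) \sum_(s <- Lambda OmegaR sigma u) s * xi u s.

Definition fdoi_feasible (R : realType) (N Omega : finType)
    (OmegaR : {set Omega}) (a : N -> Omega -> bool) (sigma : N -> Omega -> R)
    (theta : Omega -> R) (xi : N -> R -> R) : Prop :=
  [/\ forall u : N,
        1 <= \sum_(l : Omega) (a u l)%:R * theta l
             - \sum_(s <- Lambda OmegaR sigma u) xi u s,
      forall (u : N) (s : R), s \in Lambda OmegaR sigma u ->
        xi u s - \sum_(l : Omega) (beta sigma u l s)%:R * theta l <= 0,
      forall l : Omega, 0 <= theta l
    & forall (u : N) (s : R), s \in Lambda OmegaR sigma u -> 0 <= xi u s].

Definition fdoi_optimal (R : realType) (N Omega : finType)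
    (OmegaR : {set Omega}) (a : N -> Omega -> bool) (c : Omega -> R)
    (sigma : N -> Omega -> R) (theta : Omega -> R) (xi : N -> R -> R) : Prop :=
  fdoi_feasible OmegaR a sigma theta xi /\
  forall (theta' : Omega -> R) (xi' : N -> R -> R),
    fdoi_feasible OmegaR a sigma theta' xi' ->
    fdoi_objective OmegaR c sigma theta xi
      <= fdoi_objective OmegaR c sigma theta' xi'.

(* Main.v *)
(* A feasible point (theta, xi) lets one remove from each column l the item u
   in the fraction xi_(u, sigma_ul) / sum_(k : sigma_uk = sigma_ul) theta_k.
   Drawing the removed set S of each column at random, independently over the
   items with these probabilities, and moving the corresponding mass of l to
   remove l S, gives a plain covering whose coverage is at least that of
   (theta, xi) and whose cost is, by the property of the rebates, at most the
   stabilized objective.  So only the covering program with xi = 0 matters.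
   Boundedness forces its costs to be nonnegative, weights may then be capped
   at 1, and a minimum exists by compactness of the cube. *)
Require Import Defs.
From HB Require Import structures.
From mathcomp Require Import all_boot all_order all_algebra.
From mathcomp Require Import reals.
From mathcomp Require Import classical_sets topology normedtype derive.
From mathcomp Require Import function_spaces lra.

Set Implicit Arguments.
Unset Strict Implicit.
Unset Printing Implicit Defensive.

Import Order.TTheory GRing.Theory Num.Theory.
Import numFieldNormedType.Exports.
Local Open Scope ring_scope.

(** * Fractional coverings of minimum cost *)

Section SetCover.
Variables (R : realType) (N Omega : finType).
Variables (a : N -> Omega -> bool) (c : Omega -> R).

Definition covering (theta : Omega -> R) : Prop :=
  (forall l, 0 <= theta l) /\
  forall u, 1 <= \sum_(l : Omega) (a u l)%:R * theta l.

Lemma cover_cost_ge0 (theta : Omega -> R) (m : R) :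
  covering theta ->
  (forall theta', covering theta' -> m <= \sum_(l : Omega) c l * theta' l) ->
  forall l, 0 <= c l.
Proof.
move=> [theta0 thetaN] bnd l; rewrite leNgt; apply/negP => cl0.
set z := \sum_(k : Omega) c k * theta k.
have mz : m <= z by apply: bnd.
(* adding [t] to the weight of column [l] brings the cost down to [m - 1] *)
pose t : R := (z - m + 1) / - c l.
have t0 : 0 <= t by apply: divr_ge0; lra.
have ct : c l * t = m - z - 1.
  by rewrite /t invrN mulrN mulrN mulrCA divff ?lt_eqF// mulr1; lra.
have := bnd (fun k => theta k + (k == l)%:R * t) _.
under eq_bigr do rewrite mulrDr.
rewrite big_split/= -/z (bigD1 l)//= eqxx mul1r ct big1 => [|k /negbTE->];
  last by rewrite mul0r mulr0.
suff /[swap]/[apply] : covering (fun k => theta k + (k == l)%:R * t) by lra.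
have d0 k : 0 <= (k == l)%:R * t by rewrite mulr_ge0.
split=> [k|u]; first by rewrite addr_ge0.
apply: le_trans (thetaN u) _; apply: ler_sum => k _.
by rewrite ler_wpM2l// lerDl.
Qed.

(** An item covered by some column of weight at least 1 stays covered by that column alone;
    otherwise capping changes no term of its sum. *)
Lemma cover_truncate (theta : Omega -> R) :
  covering theta -> covering (fun l => Num.min (theta l) 1).
Proof.
move=> [theta0 thetaN]; split=> [l|u]; first by rewrite le_min theta0 ler01.
have term_ge0 (k : Omega) : 0 <= (a u k)%:R * Num.min (theta k) 1.
  by rewrite mulr_ge0// le_min theta0 ler01.
have [/existsP[l /andP[aul tl]]|] := boolP [exists l, a u l && (1 <= theta l)].
  by rewrite (bigD1 l)//= aul min_r// mul1r lerDl sumr_ge0.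
rewrite negb_exists => /forallP small.
rewrite (le_trans (thetaN u))// ler_sum// => l _.
have := small l; case: (a u l) => /=; last by rewrite !mul0r.
by rewrite -ltNge => /ltW/min_l->.
Qed.

Local Notation weights :=
  (prod_topology (fun _ : Omega => R : topologicalType)).

Lemma weighted_sum_continuous (w : Omega -> R) :
  continuous (fun theta : weights => \sum_(l : Omega) w l * theta l : R).
Proof.
apply: continuous_big => [|l _]; first exact: add_continuous.
move=> theta; apply: (@continuousM R weights (fun=> w l)).
  exact: cst_continuous.
exact: proj_continuous.
Qed.

Local Open Scope classical_set_scope.

Lemma cover_attained (m : R) :
  (exists theta, covering theta) ->
  (forall theta, covering theta -> m <= \sum_(l : Omega) c l * theta l) ->
  exists2 theta, covering theta &
    forall theta', covering theta' ->
      \sum_(l : Omega) c l * theta l <= \sum_(l : Omega) c l * theta' l.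
Proof.
move=> [theta1 cov1] bnd; have c0 := cover_cost_ge0 cov1 bnd.
pose box := [set theta : weights | forall l, `[0 : R, 1]%classic (theta l)].
pose cov := \bigcap_(u in [set: N])
  ((fun theta : weights => \sum_(l : Omega) (a u l)%:R * theta l : R)
     @^-1` [set x | 1 <= x]).
have truncated theta : covering theta ->
    (box `&` cov) (fun l => Num.min (theta l) 1).
  move=> /cover_truncate[h0 hN]; split=> [l|u _]; last exact: hN.
  by rewrite /= in_itv/= h0 ge_min lexx orbT.
have compact_box : compact (box `&` cov).
  apply: compact_closedI.
    apply: (@tychonoff Omega (fun=> R) (fun=> `[0 : R, 1])) => l.
    exact: segment_compact.
  apply: closed_bigI => u _.
  apply: preimage_closed; last exact: closed_ge.
  by move=> theta _; exact: weighted_sum_continuous.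
have [|theta] := compact_EVT_min _ compact_box
  (continuous_subspaceT (@weighted_sum_continuous c)).
  by exists (fun l => Num.min (theta1 l) 1); exact: truncated.
rewrite inE => -[thetab thetaN] thetamin; exists theta.
  split=> [l|u]; last exact: thetaN.
  by have := thetab l; rewrite /= in_itv/= => /andP[].
(* A covering outside the cube is compared through its truncation, which costs no more because [c]
   is nonnegative. *)
move=> theta' cov'.
apply: le_trans (thetamin _ (mem_set (truncated _ cov'))) _.
by apply: ler_sum => l _; rewrite ler_wpM2l// ge_min lexx.
Qed.

End SetCover.

(** * Random subsets with independent membership *)

Section RandomSubset.
Variables (R : realType) (N : finType).
Implicit Types (f : N -> R) (S : {set N}).

(** The probability of drawing [S] when each [u] is included independently with probability
    [f u]. *)
Definition subset_weight f S : R :=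
  \prod_(u : N) (if u \in S then f u else 1 - f u).

Lemma subset_weight_ge0 f S :
  (forall u, 0 <= f u <= 1) -> 0 <= subset_weight f S.
Proof.
move=> f01; apply: prodr_ge0 => u _; have /andP[f0 f1] := f01 u.
by case: ifP => // _; rewrite subr_ge0.
Qed.

Lemma subset_weight_eq0 f S u : u \in S -> f u = 0 -> subset_weight f S = 0.
Proof. by move=> uS fu; rewrite /subset_weight (bigD1 u)//= uS fu mul0r. Qed.

(** Expanding the product over [u] of [f u + (1 - f u) = 1] gives one term per subset. *)
Lemma sum_subset_weight f : \sum_(S : {set N}) subset_weight f S = 1.
Proof.
rewrite -(bigA_distr _ _ (fun u => f u) (fun u => 1 - f u)) big1// => u _.
by rewrite /= addrC subrK.
Qed.

Lemma sum_subset_weight_mem f u :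
  \sum_(S : {set N} | u \in S) subset_weight f S = f u.
Proof.
(* the summands with [u \notin S] are killed by changing the factor at [u] *)
pose g v := if v == u then 0 else 1 - f v.
transitivity (\prod_v (f v + g v)).
  rewrite (bigA_distr _ _ (fun u => f u) g) big_mkcond; apply: eq_bigr => S _.
  case: ifPn => uS; last first.
    by rewrite (bigD1 u)//= (negbTE uS) /g eqxx mul0r.
  apply: eq_bigr => v _; case: ifPn => // vS; rewrite /g.
  by case: eqVneq vS => // ->; rewrite uS.
rewrite (bigD1 u)//= /g eqxx addr0 big1 ?mulr1// => v /negbTE->.
by rewrite /= addrC subrK.
Qed.

(** Linearity of expectation: [u] lies in the random set with probability [f u]. *)
Lemma sum_subset_weight_sum f (h : N -> R) :
  \sum_(S : {set N}) subset_weight f S * (\sum_(u in S) h u) =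
  \sum_u f u * h u.
Proof.
under eq_bigr do rewrite mulr_sumr big_mkcond.
rewrite exchange_big; apply: eq_bigr => u _ /=.
by rewrite -big_mkcond -mulr_suml sum_subset_weight_mem.
Qed.

End RandomSubset.

(** * Redistribution of column weights by random removal *)

Section Removal.
Variables (R : realType) (N Omega : finType).
Variables (a : N -> Omega -> bool) (c : Omega -> R) (sigma : N -> Omega -> R).
Variable remove : Omega -> {set N} -> Omega.
Variables (theta : Omega -> R) (f : Omega -> N -> R).

(** The mass arriving at [k] when each [l] sends the share [subset_weight (f l) S] of its weight to
    [remove l S]. *)
Definition relocate (k : Omega) : R :=
  \sum_l theta l * \sum_(S : {set N} | remove l S == k) subset_weight (f l) S.

(** Push-forward formula: the sets [S] are grouped by their target [remove l S]. *)
Lemma sum_relocate (g : Omega -> R) :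
  \sum_k g k * relocate k =
  \sum_l theta l * \sum_S subset_weight (f l) S * g (remove l S).
Proof.
under eq_bigr do rewrite mulr_sumr.
rewrite exchange_big/=; apply: eq_bigr => l _.
under eq_bigr do rewrite mulrCA.
rewrite -mulr_sumr; congr (_ * _).
rewrite (partition_big (remove l) xpredT)//=; apply: eq_bigr => k _.
by rewrite mulr_sumr; apply: eq_bigr => S /eqP->; rewrite mulrC.
Qed.

Hypothesis theta_ge0 : forall l, 0 <= theta l.
Hypothesis f01 : forall l u, 0 <= f l u <= 1.

Lemma relocate_ge0 k : 0 <= relocate k.
Proof.
apply: sumr_ge0 => l _; rewrite mulr_ge0// sumr_ge0// => S _.
exact: subset_weight_ge0.
Qed.

Hypothesis f_bound : forall l (S : {set N}), (forall u, u \in S -> f l u != 0) ->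
  rebate_bound a c sigma remove l S.

(** A set of nonzero weight contains only items of nonzero probability, so [f_bound] applies to
    every set that matters. *)
Lemma relocate_bound l S :
  subset_weight (f l) S != 0 -> rebate_bound a c sigma remove l S.
Proof.
move=> w0; apply: f_bound => u uS; apply: contra_neq w0.
exact: subset_weight_eq0.
Qed.

(** Item [u] survives in a column covering it exactly when the drawn set misses [u], an event of
    probability [1 - f l u]. *)
Lemma relocate_cover u :
  \sum_k (a u k)%:R * relocate k =
  \sum_l (a u l)%:R * (1 - f l u) * theta l.
Proof.
rewrite sum_relocate; apply: eq_bigr => l _; rewrite mulrC; congr (_ * _).
transitivity (\sum_(S : {set N})
    (a u l)%:R * (subset_weight (f l) S * (u \notin S)%:R)).
  apply: eq_bigr => S _.
  have [->|/relocate_bound[/setP/(_ u) + _]] := eqVneq (subset_weight (f l) S) 0.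
    by rewrite !mul0r mulr0.
  by rewrite !inE => ->; rewrite mulrCA -natrM mulnb andbC.
rewrite -mulr_sumr; congr (_ * _).
rewrite -[in RHS](sum_subset_weight (f l)) -(sum_subset_weight_mem (f l)).
rewrite [X in _ - X]big_mkcond -sumrB; apply: eq_bigr => S _ /=.
by case: (u \in S); rewrite ?mulr0 ?mulr1 ?subrr ?subr0.
Qed.

(** The rebate bound holds for each set of nonzero weight; averaging it over the draw bounds the
    expected saving from below. *)
Lemma relocate_cost :
  \sum_k c k * relocate k <=
  \sum_l theta l * (c l - \sum_u f l u * sigma u l).
Proof.
rewrite sum_relocate; apply: ler_sum => l _; rewrite ler_wpM2l//.
rewrite -[c l]mul1r -[1](sum_subset_weight (f l)) mulr_suml.
rewrite -(sum_subset_weight_sum (f l) (sigma^~ l)) -sumrB; apply: ler_sum => S _.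
rewrite -mulrBr.
have [->|/relocate_bound[_ bd]] := eqVneq (subset_weight (f l) S) 0.
  by rewrite !mul0r.
by rewrite ler_wpM2l ?subset_weight_ge0//; lra.
Qed.

End Removal.

(** * Removal fractions read off a feasible point *)

Section Rebates.
Variables (R : realType) (N Omega : finType) (OmegaR : {set Omega}).
Variables (a : N -> Omega -> bool) (c : Omega -> R) (sigma : N -> Omega -> R).
Variable remove : Omega -> {set N} -> Omega.

Lemma feasible_xi0 (theta : Omega -> R) : covering a theta <->
  fdoi_feasible OmegaR a sigma theta (fun _ _ => 0).
Proof.
split=> [[theta0 thetaN]|[thetaN _ theta0 _]]; split => //.
- by move=> u; rewrite [X in _ - X]big1// subr0.
- move=> u s _; rewrite sub0r oppr_le0 sumr_ge0// => l _.
  by rewrite mulr_ge0.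
- by move=> u; have := thetaN u; rewrite [X in _ - X]big1// subr0.
Qed.

Lemma objective_xi0 (theta : Omega -> R) :
  fdoi_objective OmegaR c sigma theta (fun _ _ => 0) =
  \sum_(l : Omega) c l * theta l.
Proof.
rewrite /fdoi_objective [X in _ - X]big1 ?subr0// => u _.
by rewrite big1// => s _; rewrite mulr0.
Qed.

(* The quotient is 0 when no weight lies on columns with this rebate; then
   [xi] vanishes there by feasibility, so the junk value is harmless. *)
Definition removed_fraction (theta : Omega -> R) (xi : N -> R -> R)
    (l : Omega) (u : N) : R :=
  if (0 < sigma u l) && (sigma u l \in Lambda OmegaR sigma u) then
    xi u (sigma u l) /
      \sum_(k : Omega) (beta sigma u k (sigma u l))%:R * theta k
  else 0.

Hypothesis sigma_ge0 : forall u l, 0 <= sigma u l.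

Lemma Lambda_ge0 u s : s \in Lambda OmegaR sigma u -> 0 <= s.
Proof. by rewrite mem_undup => /mapP[l _ ->]. Qed.

Section Feasible.
Variables (theta : Omega -> R) (xi : N -> R -> R).
Hypothesis feas : fdoi_feasible OmegaR a sigma theta xi.

Lemma removed_fraction_itv l u : 0 <= removed_fraction theta xi l u <= 1.
Proof.
case: feas => _ xi_le theta0 xi0.
rewrite /removed_fraction; case: ifP => [/andP[_ sL]|]; last first.
  by rewrite lexx ler01.
set T := \sum_(_ : Omega) _.
have T0 : 0 <= T by apply: sumr_ge0 => k _; rewrite mulr_ge0.
rewrite divr_ge0 ?xi0//=.
have := xi_le _ _ sL; rewrite subr_le0 -/T => xiT.
move: T0; rewrite le_eqVlt => /predU1P[<-|T0]; first by rewrite invr0 mulr0.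
by rewrite ler_pdivrMr// mul1r.
Qed.

(** Columns with the same rebate [s] at [u] share one fraction; their weights add up to its
    denominator and cancel it, leaving [xi u s]. *)
Lemma sum_removed_fraction u (h : R -> R) :
  \sum_l removed_fraction theta xi l u * h (sigma u l) * theta l =
  \sum_(s <- Lambda OmegaR sigma u | 0 < s) h s * xi u s.
Proof.
case: feas => _ xi_le theta0 xi0.
transitivity (\sum_l \sum_(s <- Lambda OmegaR sigma u | 0 < s)
   (beta sigma u l s)%:R * theta l *
   (h s * xi u s / \sum_(k : Omega) (beta sigma u k s)%:R * theta k)).
  apply: eq_bigr => l _; rewrite /removed_fraction.
  case: ifPn => [/andP[s0 sL]|sN].
    rewrite [RHS]big_mkcond (bigD1_seq (sigma u l)) ?undup_uniq//= s0.
    rewrite /beta eqxx mul1r [X in _ + X]big1 ?addr0 => [|s ne].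
      by rewrite mulrC; congr (_ * _); rewrite mulrC mulrA.
    by rewrite eq_sym (negbTE ne) !mul0r if_same.
  rewrite !mul0r big_seq_cond big1// => s /andP[sL s0].
  rewrite /beta; case: eqVneq => [e|_]; last by rewrite !mul0r.
  by move: sN; rewrite e sL s0.
rewrite exchange_big/= big_seq_cond [RHS]big_seq_cond.
apply: eq_bigr => s /andP[sL _]; rewrite -mulr_suml.
set T := \sum_(_ : Omega) _.
have [T0|T0] := eqVneq T 0; last by rewrite mulrC divfK.
rewrite T0 mul0r; have := xi_le _ _ sL; rewrite -/T T0 subr0 => xi_le0.
by have -> : xi u s = 0 by [apply/le_anti; rewrite xi_le0 xi0|]; rewrite mulr0.
Qed.

End Feasible.

Hypothesis sigma_uncovered : forall u l, ~~ a u l -> sigma u l = 0.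
Hypothesis sigma_bound : forall l (S : {set N}), S \subset items a l ->
  (forall u, u \in S -> 0 < sigma u l /\ sigma u l \in Lambda OmegaR sigma u) ->
  rebate_bound a c sigma remove l S.

Lemma cover_le_feasible (theta : Omega -> R) (xi : N -> R -> R) :
  fdoi_feasible OmegaR a sigma theta xi ->
  exists2 theta', covering a theta' &
    \sum_(l : Omega) c l * theta' l <=
      fdoi_objective OmegaR c sigma theta xi.
Proof.
move=> feas; have f01 := removed_fraction_itv feas.
case: (feas) => thetaN xi_le theta0 xi0.
set f := removed_fraction _ _ in f01.
have f_neq0 l u : f l u != 0 ->
    0 < sigma u l /\ sigma u l \in Lambda OmegaR sigma u.
  by rewrite /f /removed_fraction; case: ifP => [/andP[]//|]; rewrite eqxx.
(* Only items with a positive rebate are removed, and a positive rebate forces coverage. *)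
have f_covered l u : f l u != 0 -> a u l.
  move=> /f_neq0[s0 _]; apply: contraTT s0 => /sigma_uncovered->.
  by rewrite ltxx.
have f_bound l (S : {set N}) : (forall u, u \in S -> f l u != 0) ->
    rebate_bound a c sigma remove l S.
  move=> fS; apply: sigma_bound => [|u /fS/f_neq0//].
  by apply/fintype.subsetP => u /fS/f_covered; rewrite inE.
exists (relocate remove theta f).
  split=> [k|u]; first exact: relocate_ge0.
  rewrite (relocate_cover _ f_bound); apply: le_trans (thetaN u) _.
  have -> : \sum_l (a u l)%:R * (1 - f l u) * theta l =
      \sum_l (a u l)%:R * theta l - \sum_l f l u * 1 * theta l.
    rewrite -sumrB; apply: eq_bigr => l _.
    have [->|/f_covered->] := eqVneq (f l u) 0.
      by rewrite subr0 mulr1 !mul0r subr0.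
    by rewrite mulr1 mul1r mulrBl mul1r.
  (* The coverage lost is at most the total of [xi], since a possible term at [s = 0] is
     nonnegative. *)
  rewrite (sum_removed_fraction feas u (fun=> 1)) lerB// big_mkcond.
  rewrite big_seq [leRHS]big_seq ler_sum// => s sL.
  by case: ifP => _; rewrite ?mul1r ?xi0.
apply: le_trans (relocate_cost theta0 f01 f_bound) _.
rewrite le_eqVlt; apply/predU1P; left.
under eq_bigr do rewrite mulrBr mulrC.
rewrite sumrB; congr (_ - _).
under eq_bigr do rewrite mulr_sumr.
rewrite exchange_big; apply: eq_bigr => u _ /=.
under eq_bigr do rewrite mulrC.
(* The value [s = 0], left out of the sum, contributes nothing to the rebate, so equality holds
   here. *)
rewrite (sum_removed_fraction feas u id) big_mkcond.
apply: eq_big_seq => s /Lambda_ge0; rewrite le_eqVlt.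
by case/predU1P => [<-|->//]; rewrite ltxx mul0r.
Qed.

End Rebates.

Theorem proposition2 (R : realType) (N Omega : finType) (OmegaR : {set Omega})
    (a : N -> Omega -> bool) (c : Omega -> R) (sigma : N -> Omega -> R)
    (remove : Omega -> {set N} -> Omega)
    (sigma_ge0 : forall (u : N) (l : Omega), 0 <= sigma u l)
    (sigma_uncovered :
       forall (u : N) (l : Omega), ~~ a u l -> sigma u l = 0)
    (sigma_restricted :
       forall (l : Omega) (S : {set N}),
         l \in OmegaR -> S \subset items a l ->
         rebate_bound a c sigma remove l S)
    (* columns outside [OmegaR] whose positive rebates occur in the program *)
    (sigma_outside :
       forall (l : Omega) (S : {set N}),
         l \notin OmegaR -> S \subset items a l ->
         (forall u : N, u \in S ->
            0 < sigma u l /\ sigma u l \in Lambda OmegaR sigma u) ->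
         rebate_bound a c sigma remove l S)
    (lp_feasible : exists (theta : Omega -> R) (xi : N -> R -> R),
       fdoi_feasible OmegaR a sigma theta xi)
    (lp_bounded : exists m : R,
       forall (theta : Omega -> R) (xi : N -> R -> R),
         fdoi_feasible OmegaR a sigma theta xi ->
         m <= fdoi_objective OmegaR c sigma theta xi) :
  exists (theta : Omega -> R) (xi : N -> R -> R),
    fdoi_optimal OmegaR a c sigma theta xi /\
    (forall (u : N) (s : R), s \in Lambda OmegaR sigma u -> xi u s = 0).
Proof.
have sigma_bound l (S : {set N}) : S \subset items a l ->
    (forall u, u \in S ->
       0 < sigma u l /\ sigma u l \in Lambda OmegaR sigma u) ->
    rebate_bound a c sigma remove l S.
  move=> Sl SL; have [lR|lR] := boolP (l \in OmegaR).
    exact: sigma_restricted.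
  exact: sigma_outside.
have to_cover := cover_le_feasible sigma_ge0 sigma_uncovered sigma_bound.
have [m bnd] := lp_bounded.
(* A lower bound for the stabilized program also bounds the coverings, which are its feasible points
   with [xi = 0]. *)
have [||theta cov thetamin] := @cover_attained _ _ _ a c m.
- have [theta [xi /to_cover[theta' cov _]]] := lp_feasible.
  by exists theta'.
- move=> theta /(feasible_xi0 OmegaR a sigma)/bnd.
  by rewrite objective_xi0.
exists theta, (fun _ _ => 0); split=> //; split.
  exact/feasible_xi0.
move=> theta' xi' /to_cover[theta'' /thetamin le1 le2].
by rewrite objective_xi0; exact: le_trans le1 le2.
Qed.
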